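(* Let $\langle G_M|R_M\rangle$ and $\langle G_N|R_N\rangle$ be finite presentations of $B_n$-persistence modules $M$ and $N$, with $G_M,G_N,R_M,R_N$ totally ordered (arbitrarily), and let $\epsilon\ge0$. Let $\mathbf{A},\mathbf{B},\mathbf{C},\mathbf{D},\mathbf{E},\mathbf{F}$ be matrices of variables, some of them constrained to be $0$, as follows: - $\mathbf{A}$ is $|G_N|\times|G_M|$, with $\mathbf{A}_{ij}$ constrained to be $0$ iff it is not the case that $gr(G_{M,j})\ge gr(G_{N,i})-\vec\epsilon$; - $\mathbf{B}$ is $|G_M|\times|G_N|$, with $\mathbf{B}_{ij}$ constrained to be $0$ iff it is not the case that $gr(G_{N,j})\ge gr(G_{M,i})-\vec\epsilon$; - $\mathbf{C}$ is $|R_N|\times|R_M|$, with $\mathbf{C}_{ij}$ constrained to be $0$ iff it is not the case that $gr(R_{M,j})\ge gr(R_{N,i})-\vec\epsilon$; - $\mathbf{D}$ is $|R_M|\times|R_N|$, with $\mathbf{D}_{ij}$ constrained to be $0$ iff it is not the case that $gr(R_{N,j})\ge gr(R_{M,i})-\vec\epsilon$; - $\mathbf{E}$ is $|R_M|\times|G_M|$, with $\mathbf{E}_{ij}$ constrained to be $0$ iff it is not the case that $gr(G_{M,j})\ge gr(R_{M,i})-2\vec\epsilon$; - $\mathbf{F}$ is $|R_N|\times|G_N|$, with $\mathbf{F}_{ij}$ constrained to be $0$ iff it is not the case that $gr(G_{N,j})\ge gr(R_{N,i})-2\vec\epsilon$. Let $T_M$ be the $|G_M|\times|R_M|$ matrix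 whose $i$-th column is $[R_{M,i},G_M]$ and $T_N$ the $|G_N|\times|R_N|$ matrix whose $i$-th column is $[R_{N,i},G_N]$. Then $M$ and $N$ are $\epsilon$-interleaved if and only if the multivariate system of quadratic equations $$\mathbf{A}T_M=T_N\mathbf{C},\qquad \mathbf{B}T_N=T_M\mathbf{D},\qquad \mathbf{B}\mathbf{A}-I_{|G_M|}=T_M\mathbf{E},\qquad \mathbf{A}\mathbf{B}-I_{|G_N|}=T_N\mathbf{F}$$ has a solution over $k$.
   Context: Fix a field $k$ and $n\ge 1$. $B_n=k[\mathbb{R}_{\ge0}^n]$ is the monoid ring of $(\mathbb{R}^n_{\ge0},+)$. A $B_n$-persistence module is a $B_n$-module $M$ with a $k$-vector space decomposition $M=\bigoplus_{a\in\mathbb{R}^n}M_a$ such that $x_i^{\alpha}(M_a)\subset M_{a+\alpha \mathbf{e}_i}$ for all $a$, $\alpha\ge0$; morphisms are module homomorphisms $f$ with $f(M_a)\subset N_a$. For $a\le b$ (product order on $\mathbb{R}^n$) the transition map $\varphi_M(a,b):M_a\to M_b$ is multiplication by $x_1^{b_1-a_1}\cdots x_n^{b_n-a_n}$. A nonzero homogeneous element $v\in M_a$ has grade $gr(v)=a$. For $v\in\mathbb{R}^n$, $M(v)_a=M_{a+v}$. For $\epsilon\ge0$ let $\vec\epsilon=(\epsilon,\dots,\epsilon)$, $M(\epsilon)=M(\vec\epsilon)$, $f(\epsilon)_a=f_{a+\vec\epsilon}$, and $S(M,\epsilon):M\to M(\epsilon)$ with $S(M,\epsilon)_a=\varphi_M(a,a+\vec\epsilon)$.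 $M,N$ are $\epsilon$-interleaved if there are morphisms $f:M\to N(\epsilon)$, $g:N\to M(\epsilon)$ with $g(\epsilon)\circ f=S(M,2\epsilon)$ and $f(\epsilon)\circ g=S(N,2\epsilon)$. An $n$-graded set is a set $G$ with a grade function $gr:G\to\mathbb{R}^n$; $\langle G\rangle=\bigoplus_{y\in G}B_n(-gr(y))$ is the free module with basis $G$. A presentation $\langle G|R\rangle$ of $M$ consists of an $n$-graded set $G$ and a set $R$ of homogeneous elements of $\langle G\rangle$ with $M\cong\langle G\rangle/\langle R\rangle$, $\langle R\rangle$ the submodule generated by $R$. For an ordered finite set $T$, $T_{,i}$ denotes its $i$-th element (so $G_{M,i}$ is the $i$-th element of $G_M$, etc.). For a finite ordered basis $G=(b_1,\dots,b_l)$ of a free module $F$ and a homogeneous $v\in F$, written uniquely as $v=\sum_{i:\,gr(v)\ge gr(b_i)}a_i\,\varphi_F(gr(b_i),gr(v))(b_i)$ with $a_i\in k$, the vector $[v,G]\in k^l$ has $i$-th entry $a_i$ if $gr(v)\ge gr(b_i)$ and $0$ otherwise. $I_m$ is the $m\times m$ identity matrix. *)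

(* Defs.v *)
From HB Require Import structures.
From mathcomp Require Import all_boot all_order all_algebra.
From mathcomp Require Import finmap boolp reals.
From mathcomp Require Import monalg.

Set Implicit Arguments.
Unset Strict Implicit.
Unset Printing Implicit Defensive.

Import Order.TTheory GRing.Theory Num.Theory.
Local Open Scope ring_scope.
Local Open Scope quotient_scope.

Section Exponents.
Variables (R : realType) (n : nat).
Implicit Types a b : 'rV[R]_n.

Definition vle a b : bool := [forall i, a 0 i <= b 0 i].

Definition diagv (e : R) : 'rV[R]_n := const_mx e.

Record nnvec := NNVec { nnval :> 'rV[R]_n; nnvalP : vle 0 nnval }.

HB.instance Definition _ := [isSub for nnval].
HB.instance Definition _ := [Choice of nnvec by <:].

Lemma vleP a b : reflect (forall i, a 0 i <= b 0 i) (vle a b).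
Proof. exact: forallP. Qed.

Lemma vle_refl a : vle a a.
Proof. by apply/vleP=> i. Qed.

Lemma vle_sub a b : vle 0 (b - a) = vle a b.
Proof. by apply/vleP/vleP=> h i; move: (h i); rewrite !mxE subr_ge0. Qed.

Lemma vle0D a b : vle 0 a -> vle 0 b -> vle 0 (a + b).
Proof.
move=> /vleP ha /vleP hb; apply/vleP=> i; rewrite mxE [leRHS]mxE.
by move: (ha i) (hb i); rewrite mxE; apply: addr_ge0.
Qed.

Lemma vle0_anti a b : vle 0 a -> vle 0 b -> a + b = 0 -> a = 0 /\ b = 0.
Proof.
move=> /vleP ha /vleP hb /rowP hab.
have H i : a 0 i = 0 /\ b 0 i = 0.
  move: (ha i) (hb i) (hab i); rewrite !mxE => ai bi /eqP.
  by rewrite paddr_eq0 // => /andP[/eqP-> /eqP->].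
by split; apply/rowP=> i; rewrite mxE; case: (H i).
Qed.

Lemma vle0_diag e : 0 <= e -> vle 0 (diagv e).
Proof. by move=> e0; apply/vleP=> i; rewrite !mxE. Qed.

Definition nn0 := NNVec (vle_refl 0).
Definition nnadd (u v : nnvec) := NNVec (vle0D (nnvalP u) (nnvalP v)).

Lemma nnaddA : associative nnadd.
Proof. by move=> u v w; apply/val_inj/addrA. Qed.
Lemma nnadd0m : left_id nn0 nnadd.
Proof. by move=> u; apply/val_inj/add0r. Qed.
Lemma nnaddm0 : right_id nn0 nnadd.
Proof. by move=> u; apply/val_inj/addr0. Qed.
Lemma nnadd_unit u v : nnadd u v = nn0 -> u = nn0 /\ v = nn0.
Proof.
move/(congr1 nnval)/(vle0_anti (nnvalP u) (nnvalP v))=> [hu hv].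
by split; apply/val_inj.
Qed.
Lemma nnaddC : commutative nnadd.
Proof. by move=> u v; apply/val_inj/addrC. Qed.

HB.instance Definition _ := Choice_isMonomialDef.Build nnvec
  nnaddA nnadd0m nnaddm0 nnadd_unit.
HB.instance Definition _ := MonomialDef_isConomialDef.Build nnvec nnaddC.

End Exponents.

(* The monoid ring k[R_{>=0}^n]; the monoid law of nnvec is vector addition. *)
Notation Bn k R n := {malg k[nnvec R n]}.

Section PersistenceModules.
Variables (k : fieldType) (R : realType) (n : nat).
Local Notation B := (Bn k R n).
Implicit Types a b : 'rV[R]_n.

(* The monomial x^a = x_1^{a_1} ... x_n^{a_n}; junk value 0 unless a >= 0. *)
Definition xpow a : B := if insub a is Some u then << (u : nnvec R n) >> else 0.

(* The coefficient of x^a in p; 0 unless a >= 0. *)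
Definition bcoef a (p : B) : k :=
  if insub a is Some u then p@_(u : nnvec R n) else 0.

(* V is the internal direct sum of the subgroups (C a)_a. *)
Definition internal_dsum (V : zmodType) (C : 'rV[R]_n -> V -> Prop) :=
  forall v : V, exists! c : {fsfun 'rV[R]_n -> V with 0},
    (forall a, C a (c a)) /\ v = \sum_(a <- finsupp c) c a.

(* The field k acts on a B-module through the constants c%:MP. *)
Record pmod := PMod {
  pcar :> lmodType B;
  pcomp : 'rV[R]_n -> pcar -> Prop;
  pcomp0 : forall a, pcomp a 0;
  pcompD : forall a u v, pcomp a u -> pcomp a v -> pcomp a (u + v);
  pcompZ : forall a (c : k) v, pcomp a v -> pcomp a ((c%:MP : B) *: v);
  pcomp_dsum : internal_dsum pcomp;
  pcomp_act : forall (i : 'I_n) (t : R) a v, 0 <= t -> pcomp a v ->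
    pcomp (a + t *: delta_mx 0 i) (xpow (t *: delta_mx 0 i) *: v) }.

Record pmor (M N : pmod) := PMor {
  pfun :> {linear M -> N};
  pfun_comp : forall a v, pcomp a v -> pcomp a (pfun v) }.

Definition pmod_iso (M N : pmod) :=
  exists (f : pmor M N) (g : pmor N M), cancel f g /\ cancel g f.

(* phi_M(a, b) : M_a -> M_b for a <= b, as a map on the whole of M. *)
Definition transition (M : pmod) a b (v : M) : M := xpow (b - a) *: v.

Lemma xpow_nn (u : nnvec R n) : xpow u = << u >>.
Proof. by rewrite /xpow valK. Qed.

Lemma xpow_ge0 a (ha : vle 0 a) : xpow a = << NNVec ha >>.
Proof. exact: (xpow_nn (NNVec ha)). Qed.

Lemma xpowN a : ~~ vle 0 a -> xpow a = 0.
Proof. by move=> ha; rewrite /xpow insubN. Qed.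

Lemma xpow0 : xpow 0 = 1.
Proof. by rewrite (xpow_ge0 (vle_refl 0)). Qed.

Lemma xpowD a b : vle 0 a -> vle 0 b -> xpow (a + b) = xpow a * xpow b.
Proof.
move=> ha hb; rewrite !xpow_ge0 ?vle0D // => hab.
rewrite malgM_def fgmulUU mulr1; congr << _ >>; exact/val_inj.
Qed.

Lemma pcomp_xpow (M : pmod) a b (v : M) :
  vle 0 b -> pcomp a v -> pcomp (a + b) (xpow b *: v).
Proof.
move=> /vleP hb hv; rewrite [b]row_sum_delta.
have: pcomp (a + \sum_(j < n) b 0 j *: delta_mx 0 j)
    (xpow (\sum_(j < n) b 0 j *: delta_mx 0 j) *: v)
  /\ vle 0 (\sum_(j < n) b 0 j *: delta_mx 0 j).
  elim/big_rec: _ => [|j c _ [IH hc]].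
    by rewrite addr0 xpow0 scale1r vle_refl.
  have hj : 0 <= b 0 j by move: (hb j); rewrite mxE.
  have hd : vle 0 (b 0 j *: delta_mx 0 j).
    by apply/vleP=> i; rewrite !mxE mulr_ge0 // ler0n.
  rewrite xpowD // -scalerA addrCA [_ + (a + c)]addrC vle0D //.
  by split=> //; apply: pcomp_act.
by case.
Qed.

Section InternalDsum.
Variables (V : zmodType) (C : 'rV[R]_n -> V -> Prop).

Lemma sum_finsupp (c : {fsfun 'rV[R]_n -> V with 0}) (s : {fset 'rV[R]_n}) :
  (forall a, a \notin s -> c a = 0) ->
  \sum_(a <- finsupp c) c a = \sum_(a <- s) c a.
Proof.
move=> cs; apply: big_fset_incl => [|a _]; last by rewrite memNfinsupp => /eqP.
by apply/fsubsetP=> a; rewrite mem_finsupp; apply: contra_neqT => /cs.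
Qed.

Definition is_proj (pr : 'rV[R]_n -> V -> V) :=
  [/\ forall a u v, pr a (u + v) = pr a u + pr a v,
      forall a v, C a (pr a v),
      forall a b v, C a v -> pr b v = if a == b then v else 0
    & forall v, exists s : {fset 'rV[R]_n}, v = \sum_(a <- s) pr a v].

Lemma proj0 pr : is_proj pr -> forall a, pr a 0 = 0.
Proof. by case=> prD _ _ _ a; apply/(addrI (pr a 0)); rewrite -prD !addr0. Qed.

Lemma proj_sum pr : is_proj pr -> forall a I (s : seq I) P (F : I -> V),
  pr a (\sum_(b <- s | P b) F b) = \sum_(b <- s | P b) pr a (F b).
Proof.
move=> hpr a I s P F; have pr0 := proj0 hpr; case: hpr => prD _ _ _.
by apply: (big_morph (pr a)) => // x y; rewrite prD.
Qed.

Lemma proj_dsum pr : is_proj pr -> internal_dsum C.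
Proof.
move=> hpr v; have pr_sum := proj_sum hpr; case: hpr => prD prC prE prS.
have [s vE] := prS v.
have outs a : a \notin s -> pr a v = 0.
  move=> nas; rewrite vE pr_sum big_seq big1 // => b bs.
  by rewrite (prE b a) //; case: eqP nas => // <-; rewrite bs.
pose c : {fsfun 'rV[R]_n -> V with 0} := [fsfun a in s => pr a v].
have cE a : c a = pr a v by rewrite fsfunE; case: ifP => // /negbT /outs.
exists c; split.
  split=> [a|]; first by rewrite cE.
  rewrite (@sum_finsupp _ s) => [|a /outs]; last by rewrite cE.
  by rewrite {1}vE; apply: eq_bigr => a _; rewrite cE.
move=> d [dC dE]; apply/fsfunP=> a; rewrite cE dE pr_sum.
under eq_bigr => b _ do rewrite (prE b a _ (dC b)).
have [ain|anin] := boolP (a \in finsupp d).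
  rewrite (big_fsetD1 a) //= eqxx big_seq big1 ?addr0 // => b.
  by rewrite !inE => /andP[/negbTE-> _].
rewrite big_seq big1 => [|b bin]; first by apply/esym/eqP; rewrite -memNfinsupp.
by case: eqP anin => // <-; rewrite bin.
Qed.

Lemma dsum_proj : (forall a, C a 0) ->
  (forall a u v, C a u -> C a v -> C a (u + v)) ->
  internal_dsum C -> exists pr, is_proj pr.
Proof.
move=> C0 CD Cds.
pose c v : {fsfun 'rV[R]_n -> V with 0} := proj1_sig (cid (Cds v)).
have cC v a : C a (c v a) by rewrite /c; case: cid => d /= [[h _] _].
have cE v : v = \sum_(a <- finsupp (c v)) c v a.
  by rewrite /c; case: cid => d /= [[_ h] _].
have cU v (s : {fset 'rV[R]_n}) (d : 'rV[R]_n -> V) :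
    (forall a, C a (d a)) -> (forall a, a \notin s -> d a = 0) ->
    v = \sum_(a <- s) d a -> forall a, c v a = d a.
  move=> dC ds vE a; pose e : {fsfun 'rV[R]_n -> V with 0} :=
    [fsfun a in s => d a].
  have eE b : e b = d b by rewrite fsfunE; case: ifP => // /negbT /ds.
  rewrite -eE /c; case: cid => f /= [_ h]; rewrite (h e) //; split=> [b|].
    by rewrite eE.
  rewrite (@sum_finsupp _ s) => [|b /ds]; last by rewrite eE.
  by rewrite {1}vE; apply: eq_bigr => b _; rewrite eE.
exists (fun a v => c v a); split=> [a u v|a v|a b v va|v].
- apply: (cU _ (finsupp (c u) `|` finsupp (c v))%fset
             (fun a => c u a + c v a)) => [b|b|].
  + by apply: CD.
  + by rewrite inE negb_or !memNfinsupp => /andP[/eqP-> /eqP->]; rewrite addr0.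
  + rewrite big_split /= {1}[u]cE {1}[v]cE; congr (_ + _);
      apply: sum_finsupp => b; rewrite inE negb_or !memNfinsupp;
      by case/andP=> /eqP ? /eqP ?.
- exact: cC.
- apply: (cU _ [fset a]%fset (fun b => if a == b then v else 0)) => [d|d|].
  + by case: eqP => [<-|].
  + by rewrite inE eq_sym => /negbTE->.
  + by rewrite big_seq_fset1 eqxx.
- by exists (finsupp (c v)); apply: cE.
Qed.

End InternalDsum.

Lemma ffun_proj (V : zmodType) (I : finType)
    (C : I -> 'rV[R]_n -> V -> Prop) (pr : I -> 'rV[R]_n -> V -> V) :
  (forall i, is_proj (C i) (pr i)) ->
  is_proj (fun a (v : {ffun I -> V}) => forall i, C i a (v i))
    (fun a v => [ffun i => pr i a (v i)]).
Proof.
move=> h; split=> [a u v|a v i|a b v va|v].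
- by apply/ffunP=> i; rewrite !ffunE; case: (h i).
- by rewrite ffunE; case: (h i).
- apply/ffunP=> i; rewrite ffunE; have [_ _ prE _] := h i; rewrite (prE a) //.
  by case: eqP => _ //; rewrite ffunE.
have /choice[s sP] : forall i, exists s : {fset 'rV[R]_n},
    v i = \sum_(a <- s) pr i a (v i) by move=> i; case: (h i).
exists (\bigcup_(i in I) s i)%fset.
apply/ffunP=> i; rewrite sum_ffunE.
rewrite (eq_bigr (fun a => pr i a (v i))) => [|a _]; last by rewrite ffunE.
rewrite {1}[v i]sP; apply: big_fset_incl => [|a _ na].
  by apply: bigfcup_sup; rewrite ?mem_index_enum.
rewrite /= {1}[v i]sP (proj_sum (h i)) big_seq big1 // => b bs.
have [_ prC prE _] := h i; rewrite (prE b a) //.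
by case: eqP na => // <-; rewrite bs.
Qed.

Lemma pmod_proj (M : pmod) : exists pr, is_proj (@pcomp M) pr.
Proof.
by apply: dsum_proj; [exact: pcomp0 | exact: pcompD | exact: pcomp_dsum].
Qed.

Section Shift.
Variables (u : 'rV[R]_n) (M : pmod).

Definition shift_comp a (v : M) := pcomp (a + u) v.

Lemma shift_dsum : internal_dsum shift_comp.
Proof.
have [pr [prD prC prE prS]] := pmod_proj M.
apply: (@proj_dsum _ _ (fun a => pr (a + u))); split=> [a|a v|a b v va|v].
- exact: prD.
- exact: prC.
- by rewrite (prE (a + u)) // (inj_eq (addIr u)).
have [s {1}->] := prS v; exists [fset (a - u) | a in s]%fset.
rewrite big_imfset /= => [|a b _ _ /addIr //].
by apply: eq_bigr => a _; rewrite subrK.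
Qed.

Lemma shift_act (i : 'I_n) (t : R) a (v : M) : 0 <= t -> shift_comp a v ->
  shift_comp (a + t *: delta_mx 0 i) (xpow (t *: delta_mx 0 i) *: v).
Proof. by move=> t0 va; rewrite /shift_comp addrAC; apply: pcomp_act. Qed.

(* M(u): the module M with the grading M(u)_a = M_{a + u}. *)
Definition pshift : pmod :=
  @PMod M shift_comp (fun a => @pcomp0 M _) (fun a => @pcompD M _)
    (fun a => @pcompZ M _) shift_dsum shift_act.

End Shift.

Section ShiftMor.
Variables (u : 'rV[R]_n) (M N : pmod) (f : pmor M N).

Lemma mshift_comp a (v : pshift u M) :
  pcomp a v -> @pcomp (pshift u N) a (f v).
Proof. exact: (@pfun_comp M N f (a + u) v). Qed.

(* f(u)_a = f_{a + u}: on elements f(u) is f itself. *)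
Definition mshift : pmor (pshift u M) (pshift u N) :=
  @PMor (pshift u M) (pshift u N) f mshift_comp.

End ShiftMor.

Local Notation pshift_diag e M := (pshift (diagv n e) M).

Section SMor.
Variables (M : pmod) (e : R) (e0 : 0 <= e).

Definition smor_fun (v : M) : pshift_diag e M := xpow (diagv n e) *: v.

Lemma smor_linear : linear smor_fun.
Proof.
by move=> p u v; rewrite /smor_fun scalerDr !scalerA [xpow _ * _]mulrC.
Qed.

HB.instance Definition _ :=
  GRing.isLinear.Build B M (pshift_diag e M) _ smor_fun smor_linear.

Lemma smor_comp a (v : M) :
  pcomp a v -> @pcomp (pshift_diag e M) a (smor_fun v).
Proof. exact: (pcomp_xpow (vle0_diag n e0)). Qed.

(* S(M, e) : M -> M(e); smorE below identifies it on M_a with the transition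
   map phi_M(a, a + e). *)
Definition smor : pmor M (pshift_diag e M) :=
  @PMor M (pshift_diag e M) smor_fun smor_comp.

Lemma smorE a (v : M) : smor v = transition a (a + diagv n e) v.
Proof. by rewrite /transition addrAC subrr add0r. Qed.

End SMor.

(* M(e)(e) and M(2e) have the same carrier, so that the two composites are
   compared as maps on elements. *)
Definition interleaved (e : R) (e0 : 0 <= e) (M N : pmod) :=
  exists (f : pmor M (pshift_diag e N)) (g : pmor N (pshift_diag e M)),
    (forall v : M, mshift (diagv n e) g (f v) = smor M (mulrn_wge0 2 e0) v) /\
    (forall v : N, mshift (diagv n e) f (g v) = smor N (mulrn_wge0 2 e0) v).

(* B as a module over itself, with B_a = k x^a (zero unless a >= 0). *)
Definition reg_comp a (p : B) := exists c : k, p = c%:MP * xpow a.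

Definition reg_part a (p : B) : B := (bcoef a p)%:MP * xpow a.

Lemma bcoefD a : {morph bcoef a : p q / p + q}.
Proof. by move=> p q; rewrite /bcoef; case: insub => [u|]; rewrite ?mcoeffD ?addr0. Qed.

Lemma bcoef_mono a b (c : k) :
  bcoef b (c%:MP * xpow a) = if (a == b) && vle 0 a then c else 0.
Proof.
have [ha|ha] := boolP (vle 0 a); last by rewrite xpowN // mulr0 andbF /bcoef;
  case: insub => // u; rewrite mcoeff0.
rewrite andbT xpow_ge0 mul_malgC /bcoef; case: insubP => [u hu uE|hb].
  rewrite mcoeffZ mcoeffU1 -val_eqE /= uE; case: eqP => _; by rewrite ?mulr1 ?mulr0.
by case: eqP hb => // <-; rewrite ha.
Qed.

Lemma reg_part_mono a b (c : k) :
  reg_part b (c%:MP * xpow a) = if a == b then c%:MP * xpow a else 0.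
Proof.
rewrite /reg_part bcoef_mono; case: eqP => /= [<-|_]; last first.
  by rewrite raddf0 mul0r.
have [ha|ha] := boolP (vle 0 a); first by [].
by rewrite (xpowN ha); apply: etrans (mulr0 _) (esym (mulr0 _)).
Qed.

Lemma reg_proj : @is_proj B^o reg_comp reg_part.
Proof.
rewrite /reg_part /=.
split=> [a p q|a p|a b p [c ->]|p].
- by rewrite bcoefD raddfD mulrDl.
- by exists (bcoef a p).
- exact: reg_part_mono.
exists [fset nnval u | u in msupp p]%fset.
rewrite big_imfset /= => [|u v _ _]; last exact: val_inj.
rewrite {1}[p]monalgE; apply: eq_bigr => u _; rewrite xpow_nn /bcoef valK.
by rewrite malgM_def fgmulUU mulr1 mul1m.
Qed.

Lemma reg_comp0 a : reg_comp a (0 : B).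
Proof. by exists 0; rewrite raddf0 mul0r. Qed.

Lemma reg_compD a p q : reg_comp a p -> reg_comp a q -> reg_comp a (p + q).
Proof. by move=> [c ->] [d ->]; exists (c + d); rewrite raddfD mulrDl. Qed.

Lemma reg_compZ a (c : k) (p : B^o) : reg_comp a p -> reg_comp a ((c%:MP : B) *: p).
Proof. by move=> [d ->]; exists (c * d); rewrite rmorphM -mulrA. Qed.

Lemma reg_act (i : 'I_n) (t : R) a (p : B^o) : 0 <= t -> reg_comp a p ->
  reg_comp (a + t *: delta_mx 0 i) (xpow (t *: delta_mx 0 i) *: p).
Proof.
move=> t0 [c ->]; have [ha|ha] := boolP (vle 0 a); last first.
  exists 0; rewrite (xpowN ha) raddf0 mul0r.
  exact: etrans (mulrA _ _ _) (mulr0 _).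
have hd : vle 0 (t *: delta_mx 0 i : 'rV[R]_n).
  by apply/vleP=> j; rewrite !mxE mulr_ge0 // ler0n.
exists c; rewrite [a + _]addrC (xpowD hd ha); exact: mulrCA.
Qed.

Definition reg_pmod : pmod :=
  @PMod B^o reg_comp reg_comp0 reg_compD reg_compZ (proj_dsum reg_proj) reg_act.

(* A finite totally ordered n-graded set, listed as 0 < 1 < ... < gsize - 1. *)
Record ngset := NGSet { gsize : nat; gr : 'I_gsize -> 'rV[R]_n }.

Section FreeModule.
Variable G : ngset.
Local Notation FV := {ffun 'I_(gsize G) -> B^o}.

Definition free_comp a (v : FV) :=
  forall i, @pcomp (pshift (- gr i) reg_pmod) a (v i).

Lemma free_dsum : internal_dsum free_comp.
Proof.
have /choice[pr prP] : forall i : 'I_(gsize G),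
    exists pr, @is_proj B^o (@pcomp (pshift (- gr i) reg_pmod)) pr.
  by move=> i; apply: pmod_proj (pshift (- gr i) reg_pmod).
exact: proj_dsum (ffun_proj prP).
Qed.

Lemma free_comp0 a : free_comp a 0.
Proof. by move=> i; rewrite ffunE; apply: pcomp0. Qed.

Lemma free_compD a u v : free_comp a u -> free_comp a v -> free_comp a (u + v).
Proof. by move=> hu hv i; rewrite ffunE; apply: pcompD. Qed.

Lemma free_compZ a (c : k) v :
  free_comp a v -> free_comp a ((c%:MP : B) *: v).
Proof. by move=> hv i; rewrite ffunE; apply: (pcompZ c (hv i)). Qed.

Lemma free_act (i : 'I_n) (t : R) a v : 0 <= t -> free_comp a v ->
  free_comp (a + t *: delta_mx 0 i) (xpow (t *: delta_mx 0 i) *: v).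
Proof. by move=> t0 hv j; rewrite ffunE; apply: (pcomp_act i t0 (hv j)). Qed.

(* <G>: the direct sum of the B(- gr i). *)
Definition free : pmod :=
  @PMod FV free_comp free_comp0 free_compD free_compZ free_dsum free_act.

Definition fbasis (i : 'I_(gsize G)) : free := [ffun j => (i == j)%:R : B^o].

(* The vector [v, G], for v homogeneous of grade d. *)
Definition coordvec d (v : free) : 'cV[k]_(gsize G) :=
  \col_i if vle (gr i) d then bcoef (d - gr i) ((v : FV) i) else 0.

Lemma fbasis_comp i : pcomp (gr i) (fbasis i).
Proof.
move=> j; rewrite ffunE; case: eqP => [<-|_]; last exact: pcomp0.
by exists 1; rewrite subrr xpow0 mulr1 mpolyC1E.
Qed.

Lemma fcomb_coord d (c : 'I_(gsize G) -> k) j :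
  (\sum_(i | vle (gr i) d)
      (((c i)%:MP : B) *: transition (gr i) d (fbasis i)) : FV) j =
  if vle (gr j) d then (c j)%:MP * xpow (d - gr j) else 0.
Proof.
rewrite sum_ffunE; under eq_bigr => i _ do rewrite !ffunE.
have off i : i != j ->
    (c i)%:MP *: (xpow (d - gr i) *: ((i == j)%:R : B^o)) = 0.
  by move=> /negbTE->; rewrite !scaler0.
have [hj|hj] := boolP (vle (gr j) d).
  rewrite (bigD1 j) //= eqxx big1 ?addr0 => [|i /andP[_ /off //]].
  by congr (_ * _); apply: mulr1.
by rewrite big1 // => i hi; apply: off; apply: contraNneq hj => <-.
Qed.

Lemma coordvecP d (v : free) : pcomp d v ->
  v = \sum_(i | vle (gr i) d)
        ((coordvec d v i 0)%:MP : B) *: transition (gr i) d (fbasis i).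
Proof.
move=> hv; apply/ffunP=> j; rewrite fcomb_coord mxE.
have [c vj] := hv j; rewrite {1}vj.
have [hj|hj] := boolP (vle (gr j) d); last by rewrite xpowN ?mulr0 // vle_sub.
by rewrite vj bcoef_mono eqxx vle_sub hj.
Qed.

Lemma coordvec_uniq d (v : free) (c : 'I_(gsize G) -> k) :
  v = \sum_(i | vle (gr i) d)
        ((c i)%:MP : B) *: transition (gr i) d (fbasis i) ->
  forall i, coordvec d v i 0 = if vle (gr i) d then c i else 0.
Proof.
move=> -> i; rewrite mxE fcomb_coord; case: ifP => [hi|//]; rewrite hi.
by rewrite bcoef_mono eqxx vle_sub hi.
Qed.

End FreeModule.

End PersistenceModules.

Section Submodules.
Variables (A : pzRingType) (V : lmodType A).

Record submod := SubMod {
  smem :> V -> Prop;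
  smem0 : smem 0;
  smemD : forall u v, smem u -> smem v -> smem (u + v);
  smemZ : forall (c : A) v, smem v -> smem (c *: v) }.

Section Span.
Variables (m : nat) (s : 'I_m -> V).

Definition span_mem (v : V) := exists c : 'I_m -> A, v = \sum_i c i *: s i.

Lemma span_mem0 : span_mem 0.
Proof. by exists (fun=> 0); rewrite big1 // => i _; rewrite scale0r. Qed.

Lemma span_memD u v : span_mem u -> span_mem v -> span_mem (u + v).
Proof.
move=> [c ->] [d ->]; exists (fun i => c i + d i); rewrite -big_split.
by apply: eq_bigr => i _; rewrite scalerDl.
Qed.

Lemma span_memZ (a : A) v : span_mem v -> span_mem (a *: v).
Proof.
move=> [c ->]; exists (fun i => a * c i); rewrite scaler_sumr.
by apply: eq_bigr => i _; rewrite scalerA.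
Qed.

Definition span_submod := SubMod span_mem0 span_memD span_memZ.

End Span.

Variable S : submod.

Definition smemb (v : V) : bool := `[< S v >].

Lemma smemb_zmod_closed : zmod_closed smemb.
Proof.
split=> [|u v /asboolP hu /asboolP hv]; apply/asboolP; first exact: smem0.
by apply: smemD => //; rewrite -scaleN1r; apply: smemZ.
Qed.

HB.instance Definition _ := GRing.isZmodClosed.Build V smemb smemb_zmod_closed.

Definition mquot := Quotient.quot (GRing.ZmodClosed.clone V smemb _).

HB.instance Definition _ := GRing.Zmodule.on mquot.

Definition mpi (v : V) : mquot := \pi v.

Lemma mpi_eq u v : mpi u = mpi v <-> S (u - v).
Proof.
split=> [/eqP|h]; first by rewrite /mpi -Quotient.idealrBE => /asboolP.
by apply/eqP; rewrite /mpi -Quotient.idealrBE; apply/asboolP.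
Qed.

Lemma mpiD : {morph mpi : u v / u + v}.
Proof. by move=> u v; rewrite /mpi !piE. Qed.

Lemma mpi_reprK (x : mquot) : mpi (repr x) = x.
Proof. exact: reprK. Qed.

Definition mscale (c : A) (x : mquot) : mquot := mpi (c *: repr x).

Lemma mscale_mpi c v : mscale c (mpi v) = mpi (c *: v).
Proof.
apply/mpi_eq; rewrite -scalerBr; apply/smemZ/mpi_eq; exact: mpi_reprK.
Qed.

Lemma mscaleA c d x : mscale c (mscale d x) = mscale (c * d) x.
Proof. by rewrite -[x]mpi_reprK !mscale_mpi scalerA. Qed.
Lemma mscale1 : left_id 1 mscale.
Proof. by move=> x; rewrite -[x]mpi_reprK mscale_mpi scale1r. Qed.
Lemma mscaleDr : right_distributive mscale +%R.
Proof.
move=> c x y; rewrite -[x]mpi_reprK -[y]mpi_reprK -mpiD !mscale_mpi.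
by rewrite scalerDr mpiD.
Qed.
Lemma mscaleDl x : {morph mscale^~ x : c d / c + d}.
Proof. by move=> c d; rewrite -[x]mpi_reprK !mscale_mpi scalerDl mpiD. Qed.

HB.instance Definition _ := GRing.Zmodule_isLmodule.Build A mquot
  mscaleA mscale1 mscaleDr mscaleDl.

Lemma mpiZ (c : A) v : mpi (c *: v) = c *: mpi v.
Proof. by rewrite -mscale_mpi. Qed.

Lemma mpi_linear : linear mpi.
Proof. by move=> c u v; rewrite mpiD mpiZ. Qed.

HB.instance Definition _ := GRing.isLinear.Build A V mquot _ mpi mpi_linear.

End Submodules.

Section Presentations.
Variables (k : fieldType) (R : realType) (n : nat).
Local Notation B := (Bn k R n).
Local Notation pmod := (pmod k R n).
Implicit Types a b : 'rV[R]_n.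

Definition graded (M : pmod) (S : submod M) := forall v, S v ->
  exists s : seq M,
    (forall w, w \in s -> S w /\ exists a, pcomp a w) /\ v = \sum_(w <- s) w.

Section Quotient.
Variables (M : pmod) (S : submod M) (gS : graded S).

Definition quot_comp a (x : mquot S) := exists2 v : M, pcomp a v & x = mpi S v.

Lemma quot_dsum : internal_dsum quot_comp.
Proof.
have [pr hpr] := pmod_proj M; have [prD prC prE prS] := hpr.
have prS_S a v : S v -> S (pr a v).
  move=> /gS[s [sP ->]]; rewrite (proj_sum hpr) big_seq.
  elim/big_ind: _ => [|x y|w /sP[Sw [b wb]]]; first exact: smem0.
    exact: smemD.
  by rewrite (prE b) //; case: eqP => _ //; apply: smem0.
have prB a u v : pr a (u - v) = pr a u - pr a v.
  by apply/esym/eqP; rewrite subr_eq -prD subrK.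
have prq a v : mpi S (pr a (repr (mpi S v))) = mpi S (pr a v).
  by apply/mpi_eq; rewrite -prB; apply/prS_S/mpi_eq/mpi_reprK.
apply: (@proj_dsum _ _ _ _ (fun a x => mpi S (pr a (repr x)))).
split=> [a x y|a x|a b x [v va ->]|x].
- by rewrite -[x in LHS]mpi_reprK -[y in LHS]mpi_reprK -mpiD prq prD mpiD.
- by exists (pr a (repr x)).
- by rewrite prq (prE a) //; case: eqP => _ //; rewrite raddf0.
have [s xs] := prS (repr x); exists s.
by rewrite -raddf_sum -xs; apply/esym/mpi_reprK.
Qed.

Lemma quot_comp0 a : quot_comp a 0.
Proof. by exists 0; [exact: pcomp0 | rewrite raddf0]. Qed.

Lemma quot_compD a x y : quot_comp a x -> quot_comp a y -> quot_comp a (x + y).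
Proof.
move=> [u hu ->] [v hv ->]; exists (u + v); [exact: pcompD|by rewrite mpiD].
Qed.

Lemma quot_compZ a (c : k) x :
  quot_comp a x -> quot_comp a ((c%:MP : B) *: x).
Proof.
by move=> [v hv ->]; exists ((c%:MP : B) *: v); [exact: pcompZ|rewrite mpiZ].
Qed.

Lemma quot_act (i : 'I_n) (t : R) a x : 0 <= t -> quot_comp a x ->
  quot_comp (a + t *: delta_mx 0 i) (xpow k (t *: delta_mx 0 i) *: x).
Proof.
move=> t0 [v hv ->]; exists (xpow k (t *: delta_mx 0 i) *: v).
  exact: pcomp_act.
by rewrite mpiZ.
Qed.

Definition pquot : pmod :=
  @PMod _ _ _ (mquot S) quot_comp quot_comp0 quot_compD quot_compZ quot_dsum
    quot_act.

End Quotient.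

Lemma span_graded (M : pmod) m (s : 'I_m -> M) :
  (forall j, exists a, pcomp a (s j)) -> graded (span_submod s).
Proof.
move=> hs v [c ->]; elim/big_ind: _ => [|x y [sx [hx ->]] [sy [hy ->]]|j _].
- by exists [::]; split=> //; rewrite big_nil.
- exists (sx ++ sy); split; last by rewrite big_cat.
  by move=> w; rewrite mem_cat => /orP[/hx|/hy].
have [a ha] := hs j.
exists [seq << (c j)@_u *g u >> *: s j | u <- msupp (c j)]; split; last first.
  by rewrite big_map -scaler_suml -monalgE.
move=> w /mapP[u _ ->]; split.
  exists (fun i => if i == j then << (c j)@_u *g u >> else 0).
  rewrite (bigD1 j) //= eqxx big1 ?addr0 // => i /negbTE->.
  by rewrite scale0r.
exists (a + u).
have -> : << (c j)@_u *g u >> = ((c j)@_u)%:MP * xpow k u :> B.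
  by rewrite xpow_nn malgM_def fgmulUU mulr1 mul1m.
rewrite -scalerA; apply/pcompZ/pcomp_xpow => //; exact: nnvalP.
Qed.

(* A finite presentation <G | R>: the j-th element of R is rel j, of grade
   gr j, for j : 'I_(gsize rels). The grade of a nonzero relation is determined
   by homogeneity; a zero relation may be given any grade. *)
Record presentation := Presentation {
  gens : ngset R n;
  rels : ngset R n;
  rel : 'I_(gsize rels) -> free k gens;
  rel_inj : injective rel;
  rel_comp : forall j, pcomp (gr j) (rel j) }.

Lemma rel_graded (P : presentation) : graded (span_submod (@rel P)).
Proof. by apply: span_graded => j; exists (gr j); apply: rel_comp. Qed.

Definition presented (P : presentation) : pmod := pquot (@rel_graded P).

Definition presents (P : presentation) (M : pmod) := pmod_iso M (presented P).

(* The |G| x |R| matrix with j-th column [R_j, G]. *)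
Definition relmx (P : presentation) :
    'M[k]_(gsize (gens P), gsize (rels P)) :=
  \matrix_(i, j) coordvec (gr j) (rel j) i 0.

(* X_ij is constrained to be 0 unless gr(H_j) >= gr(G_i) - (t, ..., t). *)
Definition constrained (G H : ngset R n) (t : R)
    (X : 'M[k]_(gsize G, gsize H)) :=
  forall i j, ~~ vle (gr i - diagv n t) (gr j) -> X i j = 0.

End Presentations.

(* Main.v *)
From Pilot Require Import Defs.
From mathcomp Require Import all_boot all_order all_algebra.
From mathcomp Require Import reals.
From HB Require Import structures.
From mathcomp Require Import boolp monalg ring.

Set Implicit Arguments.
Unset Strict Implicit.
Unset Printing Implicit Defensive.

Import Order.TTheory GRing.Theory Num.Theory.
Local Open Scope ring_scope.

(* A constrained matrix X over k and a shift t encode the homogeneous matrix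
   over the monoid ring with entries X_ij x^(gr j - gr i + t); this encoding is
   injective and multiplicative on constrained matrices. The relation submodule
   is the image of the encoded relation matrix, and a homogeneous element of it
   is the image of a homogeneous vector, because graded maps commute with the
   projections on components. Lifting a shifted morphism to the free modules
   gives A (resp. B), preservation of relations gives C (resp. D), and equality
   of the composite with multiplication by x^(2 eps) modulo relations gives
   E (resp. F). *)

(* Monomials, coordinates, matrices and the maps they induce are locked:
   otherwise every failed unification unfolds products in the monoid ring. *)
HB.lock Definition mono (k : fieldType) (R : realType) (n : nat) (c : k)
  (a : 'rV[R]_n) : Bn k R n := c%:MP * xpow k a.

HB.lock Definition coord (k : fieldType) (R : realType) (n : nat)
    (G : ngset R n) (v : Defs.free k G) (i : 'I_(gsize G)) : Bn k R n :=
  (v : {ffun 'I_(gsize G) -> (Bn k R n)^o}) i.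

HB.lock Definition hmx (k : fieldType) (R : realType) (n : nat) (t : R)
    (G H : ngset R n) (X : 'M[k]_(gsize G, gsize H)) :
    'M[Bn k R n]_(gsize G, gsize H) :=
  \matrix_(i, j) mono (X i j) (gr j + diagv n t - gr i).

HB.lock Definition hmap (k : fieldType) (R : realType) (n : nat)
    (G H : ngset R n) (X : 'M[Bn k R n]_(gsize G, gsize H)) (v : Defs.free k H) :
    Defs.free k G :=
  [ffun i => \sum_j X i j * coord v j : (Bn k R n)^o].

Lemma mxBE (V : zmodType) m p (X Y : 'M[V]_(m, p)) i j :
  (X - Y) i j = X i j - Y i j.
Proof. by rewrite !mxE. Qed.

Lemma diagv0 (R : realType) n : diagv n 0 = 0 :> 'rV[R]_n.
Proof. by apply/rowP=> i; rewrite !mxE. Qed.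

Lemma vle_shift (R : realType) n (a b : 'rV[R]_n) t :
  vle (a - diagv n t) b = vle 0 (b + diagv n t - a).
Proof. by rewrite -vle_sub opprB addrA. Qed.

(** The exponent of a product entry splits at an intermediate grade [b], which cancels. *)
Lemma shift_trans (R : realType) n (a b c : 'rV[R]_n) t s :
  c + diagv n (t + s) - a = (b + diagv n t - a) + (c + diagv n s - b).
Proof. by apply/rowP=> i; rewrite !mxE; ring. Qed.

Section GradedMatrices.
Variables (k : fieldType) (R : realType) (n : nat).
Local Notation B := (Bn k R n).
Local Notation ngset := (ngset R n).
Local Notation free := (@Defs.free k R n).
Local Notation pcomp := (@Defs.pcomp k R n _).
Implicit Types (G H K : ngset) (t s : R) (a b : 'rV[R]_n) (c d : k).

(** * Monomials of the monoid ring *)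

Lemma monoN c a : ~~ vle 0 a -> mono c a = 0 :> B.
Proof. by move=> ha; rewrite mono.unlock (xpowN _ ha) mulr0. Qed.

Lemma mono0 a : mono 0 a = 0 :> B.
Proof. by rewrite mono.unlock raddf0 mul0r. Qed.

Lemma monoB c d a : mono (c - d) a = mono c a - mono d a :> B.
Proof. by rewrite mono.unlock raddfB mulrBl. Qed.

Lemma mono_sum I (r : seq I) (F : I -> k) a :
  mono (\sum_(l <- r) F l) a = \sum_(l <- r) mono (F l) a :> B.
Proof. by rewrite mono.unlock raddf_sum mulr_suml. Qed.

(** Nonnegativity matters: for nonzero [a = - b] the right side is 0 by the default value of [xpow],
    while the left side is the constant [c * d]. *)
Lemma monoM c d a b : vle 0 a -> vle 0 b ->
  mono (c * d) (a + b) = mono c a * mono d b :> B.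
Proof.
move=> ha hb; rewrite mono.unlock (xpowD _ ha hb) rmorphM; exact: mulrACA.
Qed.

Lemma mono1 a : mono 1 a = xpow k a.
Proof. by rewrite mono.unlock mpolyC1E mul1r. Qed.

Lemma bcoef_monoK c a : vle 0 a -> bcoef a (mono c a : B) = c.
Proof. by move=> ha; rewrite mono.unlock bcoef_mono eqxx ha. Qed.

(** * Encoding of constrained matrices over the monoid ring *)

Lemma hmxE t G H (X : 'M[k]_(gsize G, gsize H)) i j :
  hmx t X i j = mono (X i j) (gr j + diagv n t - gr i).
Proof. by rewrite hmx.unlock mxE. Qed.

(** The constraints make the scalar term vanish whenever one of the two exponents is not
    nonnegative; in the remaining terms the exponents add. *)
Lemma hmxM t s G H K (X : 'M[k]_(gsize G, gsize H))
    (Y : 'M[k]_(gsize H, gsize K)) :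
  constrained t X -> constrained s Y ->
  hmx (t + s) (X *m Y) = hmx t X *m hmx s Y.
Proof.
move=> hX hY; apply/matrixP=> i j; rewrite hmxE !mxE mono_sum.
apply: eq_bigr => l _; rewrite !hmxE.
have [hil|/hX->] := boolP (vle (gr i - diagv n t) (gr l)); last first.
  by rewrite mul0r !mono0 mul0r.
have [hlj|/hY->] := boolP (vle (gr l - diagv n s) (gr j)); last first.
  by rewrite mulr0 !mono0 mulr0.
by rewrite (shift_trans _ (gr l)) monoM // -vle_shift.
Qed.

Lemma hmxB t G H (X Y : 'M[k]_(gsize G, gsize H)) :
  hmx t (X - Y) = hmx t X - hmx t Y.
Proof. by apply/matrixP=> i j; rewrite mxBE !hmxE mxBE monoB. Qed.

(** This is how the identity matrices in the quadratic system come to stand for the maps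
    [S(M, 2 eps)] and [S(N, 2 eps)]. *)
Lemma hmx1 t G :
  hmx t (1%:M : 'M[k]_(gsize G)) = (xpow k (diagv n t))%:M.
Proof.
apply/matrixP=> i j; rewrite hmxE !mxE; case: eqP => [->|_].
  by rewrite mono1 addrAC subrr add0r.
by rewrite mono0.
Qed.

Lemma bcoef_hmx t G H (X : 'M[k]_(gsize G, gsize H)) i j :
  constrained t X -> bcoef (gr j + diagv n t - gr i) (hmx t X i j) = X i j.
Proof.
move=> hX; have [h|h] := boolP (vle (gr i - diagv n t) (gr j)).
  by rewrite hmxE bcoef_monoK // -vle_shift.
by rewrite hmxE hX // mono0 /bcoef; case: insub => // u; apply: mcoeff0.
Qed.

(** Each entry is read off as a coefficient of its encoded monomial; at forbidden positions the
    encoding is 0 and the constraint supplies the entry. *)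
Lemma hmx_inj t G H (X Y : 'M[k]_(gsize G, gsize H)) :
  constrained t X -> constrained t Y -> hmx t X = hmx t Y -> X = Y.
Proof.
move=> hX hY XY; apply/matrixP=> i j.
by rewrite -(bcoef_hmx i j hX) XY bcoef_hmx.
Qed.

Lemma constrainedM t s G H K (X : 'M[k]_(gsize G, gsize H))
    (Y : 'M[k]_(gsize H, gsize K)) :
  constrained t X -> constrained s Y -> constrained (t + s) (X *m Y).
Proof.
move=> hX hY i j hij; rewrite mxE big1 // => l _.
have [hil|/hX->] := boolP (vle (gr i - diagv n t) (gr l)); last by rewrite mul0r.
have [hlj|/hY->] := boolP (vle (gr l - diagv n s) (gr j)); last by rewrite mulr0.
move: hil hlj hij; rewrite !vle_shift => hil hlj /negP[].
by rewrite (shift_trans _ (gr l)) vle0D.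
Qed.

Lemma constrainedB t G H (X Y : 'M[k]_(gsize G, gsize H)) :
  constrained t X -> constrained t Y -> constrained t (X - Y).
Proof. by move=> hX hY i j hij; rewrite mxBE hX // hY // subr0. Qed.

Lemma constrained1 t G : 0 <= t -> constrained t (1%:M : 'M[k]_(gsize G)).
Proof.
move=> t0 i j; rewrite mxE; case: eqP => [->|//].
by rewrite vle_shift addrAC subrr add0r vle0_diag.
Qed.

(** * Coordinates and matrix maps on free modules *)

Lemma coordE G (v : free G) i : coord v i = (v : {ffun 'I_(gsize G) -> B^o}) i.
Proof. by rewrite coord.unlock. Qed.

Lemma coordP G (u v : free G) : coord u =1 coord v -> u = v.
Proof. by move=> uv; apply/ffunP=> i; rewrite -!coordE. Qed.

Lemma coordD G (u v : free G) i : coord (u + v) i = coord u i + coord v i.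
Proof. by rewrite !coordE ffunE. Qed.

Lemma coordZ G (p : B) (v : free G) i : coord (p *: v) i = p * coord v i.
Proof. by rewrite !coordE ffunE. Qed.

Lemma coordB G (u v : free G) i : coord (u - v) i = coord u i - coord v i.
Proof. by rewrite -scaleN1r coordD coordZ mulN1r. Qed.

Lemma coord_basis G (i j : 'I_(gsize G)) :
  coord (fbasis k i : free G) j = (i == j)%:R.
Proof. by rewrite coordE ffunE. Qed.

Lemma coord_sum G I (r : seq I) (F : I -> free G) i :
  coord (\sum_(l <- r) F l) i = \sum_(l <- r) coord (F l) i.
Proof.
by rewrite coordE sum_ffunE; apply: eq_bigr => l _; rewrite coordE.
Qed.

Lemma coord_hmap G H (X : 'M[B]_(gsize G, gsize H)) (v : free H) i :
  coord (hmap X v) i = \sum_j X i j * coord v j.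
Proof. by rewrite coordE hmap.unlock ffunE. Qed.

Lemma hmap_is_linear G H (X : 'M[B]_(gsize G, gsize H)) : linear (hmap X).
Proof.
move=> p u v; apply: coordP => i; rewrite coordD coordZ !coord_hmap.
rewrite mulr_sumr -big_split; apply: eq_bigr => j _ /=.
rewrite coordD coordZ mulrDr; apply: (congr2 +%R _ erefl); exact: mulrCA.
Qed.

HB.instance Definition _ G H X :=
  GRing.isLinear.Build B (free H) (free G) _ (@hmap k R n G H X)
    (hmap_is_linear X).

Lemma hmapM G H K (X : 'M[B]_(gsize G, gsize H)) (Y : 'M[B]_(gsize H, gsize K))
  v : hmap (X *m Y) v = hmap X (hmap Y v).
Proof.
apply: coordP => i; rewrite !coord_hmap.
under eq_bigr => j _ do rewrite mxE mulr_suml.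
rewrite exchange_big; apply: eq_bigr => l _; rewrite coord_hmap mulr_sumr.
by apply: eq_bigr => j _; rewrite mulrA.
Qed.

Lemma hmapB G H (X Y : 'M[B]_(gsize G, gsize H)) v :
  hmap (X - Y) v = hmap X v - hmap Y v.
Proof.
apply: coordP => i; rewrite coordB !coord_hmap -sumrB.
by apply: eq_bigr => j _; rewrite mxBE mulrBl.
Qed.

Lemma hmap_scalar G (p : B) (v : free G) : hmap p%:M v = p *: v.
Proof.
apply: coordP => i; rewrite coordZ coord_hmap (bigD1 i) //= mxE eqxx mulr1n.
by rewrite big1 ?addr0 // => j; rewrite mxE eq_sym => /negbTE->; rewrite mul0r.
Qed.

Lemma hmap_basis G H (X : 'M[B]_(gsize G, gsize H)) j i :
  coord (hmap X (fbasis k j)) i = X i j.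
Proof.
rewrite coord_hmap (bigD1 j) //= coord_basis eqxx mulr1 big1 ?addr0 // => l.
by rewrite eq_sym coord_basis => /negbTE->; rewrite mulr0.
Qed.

Lemma hmap_ext G H (X Y : 'M[B]_(gsize G, gsize H)) :
  (forall j, hmap X (fbasis k j) = hmap Y (fbasis k j)) -> X = Y.
Proof.
by move=> XY; apply/matrixP=> i j; rewrite -hmap_basis XY hmap_basis.
Qed.

Lemma free_decomp G (v : free G) : v = \sum_j coord v j *: fbasis k j.
Proof.
apply: coordP => i; apply/esym; rewrite coord_sum.
under eq_bigr => j _ do rewrite coordZ coord_basis mulr_natr mulrb.
by rewrite -big_mkcond big_pred1_eq.
Qed.

(** * Homogeneous vectors and graded maps between free modules *)

Lemma pcomp_free G a (v : free G) :
  pcomp a v <-> forall i, exists c, coord v i = mono c (a - gr i).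
Proof. by split=> hv i; have := hv i; rewrite coordE mono.unlock. Qed.

(** This holds for every [X], since the encoding already kills the forbidden entries. *)
Lemma hmap_comp t G H (X : 'M[k]_(gsize G, gsize H)) a (v : free H) :
  pcomp a v -> pcomp (a + diagv n t) (hmap (hmx t X) v).
Proof.
move=> /pcomp_free hv; apply/pcomp_free=> i; rewrite coord_hmap.
have /boolp.choice[c hc] : forall j, exists c,
    hmx t X i j * coord v j = mono c (a + diagv n t - gr i).
  move=> j; have [c ->] := hv j; rewrite hmxE.
  have [h|h] := boolP (vle 0 (gr j + diagv n t - gr i)); last first.
    by exists 0; rewrite (monoN _ h) mono0 mul0r.
  have [ha|ha] := boolP (vle 0 (a - gr j)); last first.
    by exists 0; rewrite (monoN _ ha) mono0 mulr0.
  (* The grade of the [j]-th generator cancels in the sum of the exponents. *)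
  exists (X i j * c); rewrite -monoM //.
  by congr (mono _ _); apply/rowP=> m; rewrite !mxE; ring.
by exists (\sum_j c j); rewrite mono_sum; apply: eq_bigr => j _.
Qed.

(** A converse to [hmap_comp]: images of the basis of the right grades are the columns of an encoded
    matrix. *)
Lemma homogeneous_columns t G H (v : 'I_(gsize H) -> free G) :
  (forall j, pcomp (gr j + diagv n t) (v j)) ->
  exists2 X : 'M[k]_(gsize G, gsize H), constrained t X
    & forall j, v j = hmap (hmx t X) (fbasis k j).
Proof.
move=> hv.
have /boolp.choice[c hc] : forall j, exists c : 'I_(gsize G) -> k,
    forall i, coord (v j) i = mono (c i) (gr j + diagv n t - gr i).
  by move=> j; have /pcomp_free/boolp.choice[c hc] := hv j; exists c.
(* Where the monomial is 0 the scalar [c j i] is arbitrary, so it is reset to 0 to meet the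
   constraint. *)
exists (\matrix_(i, j)
    if vle (gr i - diagv n t) (gr j) then c j i else 0) => [i j /negbTE h|j].
  by rewrite mxE h.
apply: coordP => i; rewrite hmap_basis hmxE mxE hc vle_shift.
by case: ifPn => // h; rewrite !(monoN _ h).
Qed.

End GradedMatrices.

Section Presentations.
Variables (k : fieldType) (R : realType) (n : nat).
Local Notation B := (Bn k R n).
Local Notation pmod := (pmod k R n).
Local Notation presentation := (presentation k R n).
Local Notation free := (@Defs.free k R n).
Local Notation pcomp := (@Defs.pcomp k R n _).
Local Notation rel := (@Defs.rel k R n _).
Local Notation relspan P := (span_submod (@Defs.rel k R n P)).
Local Notation T P := (hmx 0 (relmx P)).
Local Notation mpi := (@Defs.mpi _ _).
Implicit Types (M N : pmod) (P Q : presentation) (H : ngset R n) (t : R).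

(** * The relation submodule as the image of a graded map *)

Lemma constrained_relmx P : constrained 0 (relmx P).
Proof. by move=> i j; rewrite diagv0 subr0 !mxE => /negbTE->. Qed.

Lemma rel_hmap P j : rel j = hmap (T P) (fbasis k j).
Proof.
apply: coordP => i; rewrite hmap_basis hmxE diagv0 addr0 !mxE.
have /pcomp_free/(_ i)[c] := rel_comp j; rewrite coordE => ->; rewrite -vle_sub.
have [h|h] := boolP (vle 0 (gr j - gr i)); last by rewrite !(monoN _ h).
by rewrite bcoef_monoK.
Qed.

Lemma relspanP P v : relspan P v <-> exists c, v = hmap (T P) c.
Proof.
split=> [[c ->]|[c ->]].
  exists (\sum_j c j *: fbasis k j); rewrite linear_sum.
  by apply: eq_bigr => j _; rewrite linearZ rel_hmap.
exists (coord c); rewrite {1}[c]free_decomp linear_sum.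
by apply: eq_bigr => j _; rewrite linearZ rel_hmap.
Qed.

(** On a homogeneous element both sides select the same component; the general case follows by
    summing components. *)
Lemma proj_morphism M N prM prN (f : {linear M -> N}) :
    is_proj (@Defs.pcomp k R n M) prM -> is_proj (@Defs.pcomp k R n N) prN ->
    (forall a v, pcomp a v -> pcomp a (f v)) ->
  forall a v, prN a (f v) = f (prM a v).
Proof.
move=> hM hN hf a v; have [_ prC prE prS] := hM; have [_ _ prE' _] := hN.
have [s vE] := prS v; rewrite vE (proj_sum hM) !linear_sum (proj_sum hN).
apply: eq_bigr => b _; rewrite (prE' b _ _ (hf _ _ (prC b v))).
rewrite (prE b _ _ (prC b v)).
by case: eqP => // _; rewrite linear0.
Qed.

(** Any preimage of [v] can be replaced by its component of grade [d], as the projections commute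
    with the encoded relation matrix. *)
Lemma relspan_homogeneous P d (v : free (gens P)) :
  pcomp d v -> relspan P v ->
  exists2 c : free (rels P), pcomp d c & v = hmap (T P) c.
Proof.
move=> vd /relspanP[c vE].
have [pr hpr] := pmod_proj (free (rels P)).
have [pr' hpr'] := pmod_proj (free (gens P)).
exists (pr d c); first by case: hpr.
rewrite -(proj_morphism hpr hpr') => [|a w wa].
  by rewrite /= -vE; case: hpr' => _ _ prE _; rewrite (prE d) // eqxx.
by have := hmap_comp 0 (relmx P) wa; rewrite diagv0 addr0.
Qed.

(** Homogeneous preimages of the columns of [Y] assemble into [Z]. This turns membership in the
    relations into a matrix equation over [k], and yields all four equations. *)
Lemma relspan_factor P H t (Y : 'M[k]_(gsize (gens P), gsize H)) :
  constrained t Y ->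
  ((forall v, relspan P (hmap (hmx t Y) v)) <->
   exists2 Z, constrained t Z & Y = relmx P *m Z).
Proof.
move=> hY; split=> [hS|[Z hZ ->] v]; last first.
  apply/relspanP; exists (hmap (hmx t Z) v).
  by rewrite -hmapM -hmxM ?add0r //; apply: constrained_relmx.
have /boolp.choice[c hc] : forall j, exists c : free (rels P),
    pcomp (gr j + diagv n t) c /\ hmap (hmx t Y) (fbasis k j) = hmap (T P) c.
  move=> j; have [c] := relspan_homogeneous
    (hmap_comp t Y (@fbasis_comp k R n H j)) (hS (fbasis k j)).
  by exists c.
have [Z hZ cE] := homogeneous_columns (fun j => (hc j).1).
exists Z => //; apply: (hmx_inj hY).
  by rewrite -[t]add0r; apply: constrainedM => //; apply: constrained_relmx.
rewrite -{2}[t]add0r hmxM //; last exact: constrained_relmx.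
by apply: hmap_ext => j; rewrite hmapM -cE; case: (hc j).
Qed.

(** The relations of [P] are the image of [T P], so [relspan_factor] applies to the product of [A]
    with the relation matrix of [P]. *)
Lemma relspan_morphism P Q t (A : 'M[k]_(gsize (gens Q), gsize (gens P))) :
  constrained t A ->
  ((forall v, relspan P v -> relspan Q (hmap (hmx t A) v)) <->
   exists2 C, constrained t C & A *m relmx P = relmx Q *m C).
Proof.
move=> hA; have hT := @constrained_relmx P.
have hAT : constrained t (A *m relmx P).
  by rewrite -[t]addr0; apply: constrainedM.
have AT v : hmap (hmx t (A *m relmx P)) v = hmap (hmx t A) (hmap (T P) v).
  by rewrite -[in LHS](addr0 t) hmxM // hmapM.
rewrite -(relspan_factor hAT); split=> [hS v|hS v /relspanP[c ->]].
  by rewrite AT; apply: hS; apply/relspanP; exists v.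
by rewrite -AT.
Qed.

(** * Lifting and descending shifted morphisms *)

(** For linear [f] this is a morphism from [M] to [N(t)]; shifting leaves the carrier unchanged. *)
Definition shifts t M N (f : M -> N) :=
  forall a v, pcomp a v -> pcomp (a + diagv n t) (f v).

Definition lifts t P Q (f : presented P -> presented Q)
    (A : 'M[k]_(gsize (gens Q), gsize (gens P))) :=
  forall v, f (mpi (relspan P) v) = mpi (relspan Q) (hmap (hmx t A) v).

(** The image of a generator is homogeneous in the quotient, hence has a homogeneous representative;
    these representatives are the columns of [A]. *)
Lemma lift_morphism t P Q (f : {linear presented P -> presented Q}) :
  shifts t f -> exists2 A, constrained t A & lifts t f A.
Proof.
move=> hf.
have /boolp.choice[v hv] : forall j : 'I_(gsize (gens P)),
    exists v : free (gens Q), pcomp (gr j + diagv n t) v /\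
      f (mpi (relspan P) (fbasis k j)) = mpi (relspan Q) v.
  move=> j; have := hf (gr j) (mpi (relspan P) (fbasis k j)).
  case=> [|v va ->]; last by exists v.
  by exists (fbasis k j) => //; apply: fbasis_comp.
have [A hA vE] := homogeneous_columns (fun j => (hv j).1).
exists A => // w; rewrite [w]free_decomp !linear_sum.
apply: eq_bigr => j _; rewrite !linearZ /= -vE.
by congr (_ *: _); case: (hv j).
Qed.

Lemma lifts_relspan t P Q (f : {linear presented P -> presented Q}) A v :
  lifts t f A -> relspan P v -> relspan Q (hmap (hmx t A) v).
Proof.
move=> fA hv; rewrite -[hmap _ _]subr0; apply/mpi_eq; rewrite -fA.
have /mpi_eq-> : relspan P (v - 0) by rewrite subr0.
by rewrite !linear0.
Qed.

(** The map is computed on chosen representatives; preservation of relations makes it independent of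
    the choice, and linearity follows. *)
Lemma descend_morphism t P Q (A : 'M[k]_(gsize (gens Q), gsize (gens P))) :
  (forall v, relspan P v -> relspan Q (hmap (hmx t A) v)) ->
  exists2 f : {linear presented P -> presented Q}, shifts t f & lifts t f A.
Proof.
move=> hA; pose f (x : presented P) : presented Q :=
  mpi (relspan Q) (hmap (hmx t A) (repr x)).
have fE v : f (mpi (relspan P) v) = mpi (relspan Q) (hmap (hmx t A) v).
  by apply/mpi_eq; rewrite -linearB; apply/hA/mpi_eq/mpi_reprK.
have f_lin : linear f.
  move=> p x y; rewrite -[x]mpi_reprK -[y]mpi_reprK -linearP !fE.
  by rewrite !linearP.
pose fL : {linear presented P -> presented Q} :=
  HB.pack f (GRing.isLinear.Build B _ _ _ f f_lin).
exists fL => // a x [v va ->]; exists (hmap (hmx t A) v); last exact: fE.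
exact: hmap_comp.
Qed.

(** The matrix [A' *m A - 1%:M] encodes the lifted composite minus multiplication by x^(2t); the
    composite is as required iff this difference takes values in the relations. *)
Lemma compose_lifts t P Q (f : presented P -> presented Q)
    (g : presented Q -> presented P) A A' :
  0 <= t -> constrained t A -> constrained t A' ->
  lifts t f A -> lifts t g A' ->
  ((forall x, g (f x) = xpow k (diagv n (t *+ 2)) *: x) <->
   exists2 E, constrained (t *+ 2) E & A' *m A - 1%:M = relmx P *m E).
Proof.
move=> t0 hA hA' fA gA'.
have hAA : constrained (t *+ 2) (A' *m A - 1%:M).
  by apply: constrainedB; [exact: constrainedM|exact/constrained1/mulrn_wge0].
rewrite -(relspan_factor hAA).
have E v : hmap (hmx (t *+ 2) (A' *m A - 1%:M)) v =
    hmap (hmx t A') (hmap (hmx t A) v) - xpow k (diagv n (t *+ 2)) *: v.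
  by rewrite hmxB hmapB hmx1 hmap_scalar [in LHS]mulr2n hmxM // hmapM.
split=> gf v.
  by rewrite E; apply/mpi_eq; rewrite -gA' -fA gf linearZ.
by rewrite -[v]mpi_reprK fA gA' -linearZ; apply/mpi_eq; rewrite -E.
Qed.

(** * Interleavings without shifted modules, and their invariance under isomorphism *)

Lemma interleaved_maps eps (e0 : 0 <= eps) M N :
  interleaved e0 M N <->
  exists (f : {linear M -> N}) (g : {linear N -> M}),
    [/\ shifts eps f, shifts eps g,
        forall v, g (f v) = xpow k (diagv n (eps *+ 2)) *: v
      & forall v, f (g v) = xpow k (diagv n (eps *+ 2)) *: v].
Proof.
split=> [[f [g [gf fg]]]|[f [g [hf hg gf fg]]]].
  by exists (pfun f), (pfun g); split;
    [exact: (pfun_comp f)|exact: (pfun_comp g)|exact: gf|exact: fg].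
by exists (@PMor _ _ _ M (pshift (diagv n eps) N) f hf),
  (@PMor _ _ _ N (pshift (diagv n eps) M) g hg).
Qed.

Lemma pmod_iso_sym M N : pmod_iso M N -> pmod_iso N M.
Proof. by move=> [f [g [fK gK]]]; exists g, f. Qed.

(** Conjugation by the isomorphisms works because they are linear, hence commute with multiplication
    by x^(2 eps). *)
Lemma interleaved_iso eps (e0 : 0 <= eps) M M' N N' :
  pmod_iso M M' -> pmod_iso N N' ->
  interleaved e0 M N -> interleaved e0 M' N'.
Proof.
move=> [i [i' [iK i'K]]] [j [j' [jK j'K]]] /interleaved_maps.
move=> [f [g [hf hg gf fg]]]; apply/interleaved_maps.
exists (pfun j \o f \o pfun i'), (pfun i \o g \o pfun j').
split=> [a v va|a v va|v|v] /=.
- by apply/pfun_comp/hf/pfun_comp.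
- by apply/pfun_comp/hg/pfun_comp.
- by rewrite jK gf linearZ i'K.
- by rewrite iK fg linearZ j'K.
Qed.

Lemma interleaved_isoE eps (e0 : 0 <= eps) M M' N N' :
  pmod_iso M M' -> pmod_iso N N' ->
  interleaved e0 M N <-> interleaved e0 M' N'.
Proof.
by move=> iM iN; split; apply: interleaved_iso => //; apply: pmod_iso_sym.
Qed.

End Presentations.

Theorem theorem2p11p5 (k : fieldType) (R : realType) (n : nat) (hn : (0 < n)%N)
    (M N : pmod k R n) (PM PN : presentation k R n)
    (hPM : presents PM M) (hPN : presents PN N)
    (eps : R) (heps : 0 <= eps) :
  interleaved heps M N <->
  exists (A : 'M[k]_(gsize (gens PN), gsize (gens PM)))
         (B : 'M[k]_(gsize (gens PM), gsize (gens PN)))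
         (C : 'M[k]_(gsize (rels PN), gsize (rels PM)))
         (D : 'M[k]_(gsize (rels PM), gsize (rels PN)))
         (E : 'M[k]_(gsize (rels PM), gsize (gens PM)))
         (F : 'M[k]_(gsize (rels PN), gsize (gens PN))),
    [/\ constrained eps A, constrained eps B & constrained eps C] /\
    [/\ constrained eps D, constrained (eps *+ 2) E
      & constrained (eps *+ 2) F] /\
    [/\ A *m relmx PM = relmx PN *m C,
        B *m relmx PN = relmx PM *m D,
        B *m A - 1%:M = relmx PM *m E
      & A *m B - 1%:M = relmx PN *m F].
Proof.
rewrite (interleaved_isoE heps hPM hPN) interleaved_maps; split.
  move=> [f [g [hf hg gf fg]]].
  have [A hA fA] := lift_morphism hf; have [B hB gB] := lift_morphism hg.
  have [C hC AC] := (relspan_morphism hA).1 (fun v => lifts_relspan fA).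
  have [D hD BD] := (relspan_morphism hB).1 (fun v => lifts_relspan gB).
  have [E hE BAE] := (compose_lifts heps hA hB fA gB).1 gf.
  have [F hF ABF] := (compose_lifts heps hB hA gB fA).1 fg.
  by exists A, B, C, D, E, F.
(* Conversely, [C] and [D] let [A] and [B] descend to the quotients, and [E] and [F] give the two
   composites. *)
move=> [A [B [C [D [E [F [[hA hB hC] [[hD hE hF] [AC BD BAE ABF]]]]]]]]].
have [f hf fA] :=
  descend_morphism ((relspan_morphism hA).2 (ex_intro2 _ _ C hC AC)).
have [g hg gB] :=
  descend_morphism ((relspan_morphism hB).2 (ex_intro2 _ _ D hD BD)).
exists f, g; split=> //.
  by apply/(compose_lifts heps hA hB fA gB); exists E.
by apply/(compose_lifts heps hB hA gB fA); exists F.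
Qed.
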